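(* Let $m$ be a positive integer, $r$ a nonnegative integer, $\lambda\in\mathbb{R}$, and $n\ge k\ge0$. Then $$W_{m,\lambda}^{(r)}(n,k)=\sum_{i=k}^{n}\binom{n}{i}(r)_{n-i,\lambda}m^{i-k}S_{2,\frac{\lambda}{m}}(i,k).$$
   Context: $(x)_{0,\lambda}=1$, $(x)_{n,\lambda}=x(x-\lambda)\cdots(x-(n-1)\lambda)$, $(x)_n=(x)_{n,1}$. The degenerate Stirling numbers of the second kind are defined by $(x)_{n,\lambda}=\sum_{k=0}^n S_{2,\lambda}(n,k)(x)_k$. The degenerate $r$-Whitney numbers of the second kind are defined by $(mx+r)_{n,\lambda}=\sum_{k=0}^n W_{m,\lambda}^{(r)}(n,k)m^k(x)_k$ (polynomial identity in $x$). *)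

(* Defs.v *)
From HB Require Import structures.
From mathcomp Require Import all_boot all_order all_algebra.
From mathcomp Require Import reals.

Set Implicit Arguments.
Unset Strict Implicit.
Unset Printing Implicit Defensive.

Import Order.TTheory GRing.Theory Num.Theory.
Local Open Scope ring_scope.

(* (x)_{n,lam}; the ring A is generic so that the same notion serves both for
   scalars and for polynomials (with x := 'X, lam := lam%:P). *)
Definition dffact (A : comNzRingType) (x lam : A) (n : nat) : A :=
  \prod_(i < n) (x - lam *+ i).

(* S is a family of degenerate Stirling numbers of the second kind S_{2,lam}.
   Only the values S n k with k <= n are constrained; they exist and are unique
   (is_dstirling2_ex, is_dstirling2_uniq). *)
Definition is_dstirling2 (R : realType) (lam : R) (S : nat -> nat -> R) : Prop :=
  forall n, dffact ('X : {poly R}) lam%:P n =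
            \sum_(k < n.+1) S n k *: dffact 'X 1 k.

(* W is a family of degenerate r-Whitney numbers of the second kind
   W_{m,lam}^{(r)}; same remark on the range k <= n, for m > 0. *)
Definition is_dwhitney2 (R : realType) (m r : nat) (lam : R)
    (W : nat -> nat -> R) : Prop :=
  forall n, dffact (m%:R * 'X + r%:R : {poly R}) lam%:P n =
            \sum_(k < n.+1) (W n k * m%:R ^+ k) *: dffact 'X 1 k.

Section ExistenceUniqueness.
Variable R : realType.
Implicit Types (p : {poly R}) (c : nat -> R) (lam : R).

Let ff n : {poly R} := dffact 'X 1 n.

Lemma dffactX_monic n : ff n \is monic.
Proof.
rewrite /ff /dffact; apply: monic_prod => i _.
by rewrite -polyC1 -polyCMn monicXsubC.
Qed.

Lemma size_dffactX n : size (ff n) = n.+1.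
Proof.
rewrite /ff /dffact.
under eq_bigr => i _ do rewrite -polyC1 -polyCMn.
by rewrite size_prod_XsubC /index_enum -enumT size_enum_ord.
Qed.

Lemma dffactX_coords n p : (size p <= n)%N ->
  {c : nat -> R | p = \sum_(k < n) c k *: ff k}.
Proof.
elim: n p => [|n IHn] p sp.
  exists (fun=> 0); rewrite big_ord0; apply/eqP.
  by rewrite -size_poly_eq0 -leqn0.
have [|c Ec] := IHn (p - p`_n *: ff n).
  apply/leq_sizeP => j; rewrite leq_eqVlt => /orP[/eqP <-|ltnj].
    have := dffactX_monic n; rewrite monicE lead_coefE size_dffactX /= => /eqP e.
    by rewrite coefB coefZ e mulr1 subrr.
  rewrite coefB coefZ [p`_j]nth_default ?(leq_trans sp ltnj) //.
  by rewrite [(ff n)`_j]nth_default ?size_dffactX // mulr0 subrr.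
exists (fun k => if k == n then p`_n else c k).
rewrite big_ord_recr /= eqxx; apply/eqP; rewrite -subr_eq Ec; apply/eqP.
by apply: eq_bigr => k _; rewrite ltn_eqF.
Qed.

Lemma dffactX_free n c : \sum_(k < n) c k *: ff k = 0 ->
  forall k, (k < n)%N -> c k = 0.
Proof.
elim: n => // n IHn; rewrite big_ord_recr /= => E.
have cn : c n = 0.
  have := congr1 (fun p : {poly R} => p`_n) E.
  have := dffactX_monic n; rewrite monicE lead_coefE size_dffactX /= => /eqP e.
  rewrite coefD coefZ e mulr1 coef0 coef_sum big1 ?add0r // => i _.
  by rewrite coefZ nth_default ?mulr0 // size_dffactX.
move=> k; rewrite ltnS leq_eqVlt => /orP[/eqP -> //|]; apply: IHn.
by move: E; rewrite cn scale0r addr0.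
Qed.

Lemma dffactX_inj n c c' :
  \sum_(k < n) c k *: ff k = \sum_(k < n) c' k *: ff k ->
  forall k, (k < n)%N -> c k = c' k.
Proof.
move=> E k kn; apply/eqP; rewrite -subr_eq0; apply/eqP.
apply: (@dffactX_free n (fun k => c k - c' k)) kn.
under eq_bigr => i _ do rewrite scalerBl.
by rewrite sumrB E subrr.
Qed.

Lemma size_dffact_le (p : {poly R}) lam n :
  (size p <= 2)%N -> (size (dffact p lam%:P n) <= n.+1)%N.
Proof.
move=> sp; elim: n => [|n IHn].
  by rewrite /dffact big_ord0 size_poly1.
rewrite /dffact big_ord_recr /=; apply: leq_trans (size_polyMleq _ _) _.
have s2 : (size (p - lam%:P *+ n)%R <= 2)%N.
  rewrite -polyCMn; apply: leq_trans (size_polyD _ _) _.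
  by rewrite geq_max sp size_polyN (leq_trans (size_polyC_leq1 _)).
have := leq_add IHn s2; rewrite addn2 -/(dffact p lam%:P n).
by case: (_ + _)%N => //.
Qed.

Lemma is_dstirling2_ex lam : exists S, is_dstirling2 lam S.
Proof.
have H n := dffactX_coords (@size_dffact_le 'X lam n (eq_leq (size_polyX R))).
by exists (fun n => sval (H n)) => n; apply: (svalP (H n)).
Qed.

Lemma is_dstirling2_uniq lam S S' :
  is_dstirling2 lam S -> is_dstirling2 lam S' ->
  forall n k, (k <= n)%N -> S n k = S' n k.
Proof.
move=> HS HS' n k kn; apply: (@dffactX_inj n.+1 (S n) (S' n)) => //.
by rewrite -HS -HS'.
Qed.

Lemma is_dwhitney2_ex m r lam : (0 < m)%N -> exists W, is_dwhitney2 m r lam W.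
Proof.
move=> m0.
have sz : (size (m%:R * 'X + r%:R : {poly R})%R <= 2)%N.
  rewrite -!polyC_natr -cons_poly_def size_cons_poly; case: ifP => // _.
  by rewrite ltnS size_polyC_leq1.
have H n := dffactX_coords (@size_dffact_le _ lam n sz).
exists (fun n k => sval (H n) k / m%:R ^+ k) => n.
rewrite [LHS](svalP (H n)); apply: eq_bigr => k _.
by rewrite divfK // expf_neq0 // pnatr_eq0 -lt0n.
Qed.

Lemma is_dwhitney2_uniq m r lam W W' : (0 < m)%N ->
  is_dwhitney2 m r lam W -> is_dwhitney2 m r lam W' ->
  forall n k, (k <= n)%N -> W n k = W' n k.
Proof.
move=> m0 HW HW' n k kn.
have u : (m%:R : R) ^+ k != 0 by rewrite expf_neq0 // pnatr_eq0 -lt0n.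
apply: (mulIf u).
apply: (@dffactX_inj n.+1 (fun k => W n k * m%:R ^+ k)
                          (fun k => W' n k * m%:R ^+ k)) => //.
by rewrite -HW -HW'.
Qed.

End ExistenceUniqueness.

(* Main.v *)
Require Import Defs.
From mathcomp Require Import all_boot all_order all_algebra.
From mathcomp Require Import reals.
Import Order.TTheory GRing.Theory Num.Theory.
Local Open Scope ring_scope.

(** The degenerate Vandermonde identity expands [(m x + r)_{n,lam}] as the sum
    of the [C(n,i) (m x)_{i,lam} (r)_{n-i,lam}], and
    [(m x)_{i,lam} = m^i (x)_{i,lam/m}] is expanded by the Stirling numbers.
    Compare coefficients on the basis of falling factorials. *)

Lemma dffactS (A : comNzRingType) (x lam : A) n :
  dffact x lam n.+1 = dffact x lam n * (x - lam *+ n).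
Proof. by rewrite /dffact big_ord_recr. Qed.

(** Induction on [n]: the new factor [x + y - lam *+ n] splits as
    [(x - lam *+ i) + (y - lam *+ (n - i))], each part extending one of the two products, and
    Pascal's rule recombines the coefficients. *)
Lemma dffactD (A : comNzRingType) (x y lam : A) n :
  dffact (x + y) lam n =
  \sum_(i < n.+1) (dffact x lam i * dffact y lam (n - i)) *+ 'C(n, i).
Proof.
elim: n => [|n IHn].
  by rewrite big_ord_recl big_ord0 /dffact !big_ord0 mulr1 addr0.
rewrite dffactS IHn mulr_suml.
transitivity (\sum_(i < n.+1)
    ((dffact x lam i.+1 * dffact y lam (n - i)) *+ 'C(n, i) +
     (dffact x lam i * dffact y lam (n.+1 - i)) *+ 'C(n, i))).
  apply: eq_bigr => i _; have le_in : (i <= n)%N by rewrite -ltnS.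
  rewrite subSn // !dffactS -mulrnDl [LHS]mulrnAl; congr (_ *+ _).
  have -> : x + y - lam *+ n = (x - lam *+ i) + (y - lam *+ (n - i)).
    by rewrite addrACA -opprD -mulrnDr subnKC.
  by rewrite mulrDr mulrAC mulrA.
rewrite big_split /= [in RHS]big_ord_recl /=.
under [in RHS]eq_bigr => i _ do rewrite /bump /= add1n binS mulrnDr subSS.
rewrite [in X in _ = _ + X]big_split /= [X in _ + X = _]big_ord_recl /=.
(* The top term vanishes because ['C(n, n.+1)] is zero. *)
rewrite [in X in _ = _ + (X + _)]big_ord_recr /= (bin_small (ltnSn n)).
rewrite mulr0n addr0 !bin0.
by rewrite addrCA [X in _ + X]addrC.
Qed.

Lemma dffactM (A : comNzRingType) (a x lam : A) n :
  dffact (a * x) (a * lam) n = a ^+ n * dffact x lam n.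
Proof.
rewrite /dffact -[in a ^+ n](card_ord n) -prodr_const -big_split /=.
by apply: eq_bigr => i _; rewrite mulrBr mulrnAr.
Qed.

Lemma rmorph_dffact (A B : comNzRingType) (f : {rmorphism A -> B}) x lam n :
  f (dffact x lam n) = dffact (f x) (f lam) n.
Proof.
rewrite /dffact rmorph_prod; apply: eq_bigr => i _.
by rewrite rmorphB rmorphMn.
Qed.

Theorem theorem4 (R : realType) (m r : nat) (lam : R)
  (W S2 : nat -> nat -> R) (n k : nat)
  (m_gt0 : (0 < m)%N)
  (defW : is_dwhitney2 m r lam W)
  (defS : is_dstirling2 (lam / m%:R) S2)
  (le_kn : (k <= n)%N) :
  W n k = \sum_(k <= i < n.+1)
            'C(n, i)%:R * dffact r%:R lam (n - i) * m%:R ^+ (i - k) * S2 i k.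
Proof.
have m_neq0 : (m%:R : R) != 0 by rewrite pnatr_eq0 -lt0n.
pose F k i : R :=
  'C(n, i)%:R * dffact r%:R lam (n - i) * m%:R ^+ (i - k) * S2 i k.
(* The coordinates in [defW] are [W n k * m%:R ^+ k], hence the extra power of [m]. *)
apply: (mulIf (expf_neq0 k m_neq0)).
apply: (@dffactX_inj R n.+1 (fun k => W n k * m%:R ^+ k)
  (fun k => (\sum_(k <= i < n.+1) F k i) * m%:R ^+ k)) => //.
rewrite -defW dffactD.
(* Triangular sum over [j <= i <= n]; summing over [i] first gives the coordinate at [j]. *)
transitivity (\sum_(i < n.+1) \sum_(j < n.+1 | (j <= i)%N)
    (F j i * m%:R ^+ j) *: (dffact 'X 1 j : {poly R})); last first.
  rewrite (exchange_big_dep xpredT) //=; apply: eq_bigr => j _.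
  by rewrite big_geq_mkord mulr_suml scaler_suml.
apply: eq_bigr => i _.
have -> : lam%:P = m%:R * (lam / m%:R)%:P :> {poly R}.
  by rewrite -polyC_natr -polyCM mulrC divfK.
(* The substitution for [lam%:P] also hit the factor in [r]; there it is folded back. *)
rewrite dffactM defS -polyC_natr -polyCM [m%:R * _]mulrC divfK //.
rewrite -[r%:R]polyC_natr -rmorph_dffact -polyC_exp mul_polyC.
rewrite (big_ord_widen n.+1 (fun j => S2 i j *: (dffact 'X 1 j : {poly R}))) //.
rewrite mulrC mul_polyC -scaler_nat !scaler_sumr.
apply: eq_big => // j le_ji; rewrite !scalerA; congr (_ *: _).
have {}le_ji : (j <= i)%N by [].
(* Since [j <= i], the powers [i - j] and [j] of [m] combine to the power [i] from [dffactM]. *)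
by rewrite /F [RHS]mulrAC -[in RHS](mulrA _ _ (_ ^+ j)) -exprD subnK // !mulrA.
Qed.
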